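(* Let $G$ be a locally compact group and let $N$ be a closed, co-compact normal subgroup of $G$. If the pair $(G,N)$ has the relative Howe-Moore property, then $G$ has property $BP_{L^2}$. In particular every Howe-Moore group has property $BP_{L^2}$.
   Context: Let $H$ be a closed subgroup of a locally compact group $G$. The pair $(G,H)$ has the relative Howe-Moore property if every unitary representation $\pi$ of $G$ either has non-zero $H$-invariant vectors, or is such that $\pi|_H$ is a $C_0$-representation (all matrix coefficients of $\pi|_H$ vanish at infinity on $H$). $G$ is a Howe-Moore group if the pair $(G,G)$ has the relative Howe-Moore property. $G$ has property $BP_{L^2}$ if every continuous affine isometric action of $G$ on an $L^2$-space $L^2(X,\mu)$ is either bounded (all orbits are bounded) or proper (for every point $x$, $\|gx-x\|\to\infty$ as $g\to\infty$ in $G$, i.e. $\{g:\|gx-x\|\le R\}$ is relatively compact for every $R$). *)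

(* Defs.v *)
From HB Require Import structures.
From mathcomp Require Import all_boot all_order all_algebra.
From mathcomp Require Import sesquilinear complex.
From mathcomp Require Import all_classical all_reals all_analysis.
From mathcomp Require Import measurable_realfun ess_sup_inf.

Set Implicit Arguments.
Unset Strict Implicit.
Unset Printing Implicit Defensive.

Import Order.TTheory GRing.Theory Num.Def Num.Theory.
Import numFieldNormedType.Exports.

Local Open Scope classical_set_scope.
Local Open Scope ring_scope.

HB.mixin Record isTopologicalGroup G & Topological G & Group G := {
  mulg_continuous : continuous (fun x : G * G => (x.1 * x.2)%g) ;
  invg_continuous : continuous (fun x : G => (x^-1)%g)
}.

#[short(type="topologicalGroupType")]
HB.structure Definition TopologicalGroup :=
  {G of Topological G & Group G & isTopologicalGroup G}.

(* Locally compact groups are Hausdorff by convention. *)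
Definition locally_compact_group (G : topologicalGroupType) :=
  hausdorff_space G /\ locally_compact [set: G].

Section Cosets.
Variables (G : topologicalGroupType) (N : groupClosed G).

Definition normal_subgroup := forall g n : G, n \in N -> (n ^ g)%g \in N.

Definition coset_rel (x y : G) := (x^-1 * y)%g \in N.

Lemma coset_rel_refl : reflexive coset_rel.
Proof. by move=> x; rewrite /coset_rel mulVg gpred1. Qed.

Lemma coset_rel_sym : symmetric coset_rel.
Proof. by move=> x y; rewrite /coset_rel -gpredV invgM invgK. Qed.

Lemma coset_rel_trans : transitive coset_rel.
Proof.
move=> y x z xy yz; rewrite /coset_rel.
by rewrite -[z](mulVKg y) mulgA gpredM.
Qed.

Canonical coset_equiv :=
  EquivRel coset_rel coset_rel_refl coset_rel_sym coset_rel_trans.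

Definition coset_space := quotient_topology {eq_quot coset_rel}%qT.

HB.instance Definition _ := Topological.on coset_space.

Definition cocompact := compact [set: coset_space].

End Cosets.

(* The norm of a complex Hilbert space takes its values in R[i]. *)
HB.mixin Record isHilbert (R : realType) H & CompleteNormedModule R[i] H := {
  hdot : {dot H for @Num.conj R[i]} ;
  hdot_norm : forall x : H, `|x| ^+ 2 = hdot x x
}.

#[short(type="hilbertType")]
HB.structure Definition Hilbert (R : realType) :=
  {H of CompleteNormedModule R[i] H & isHilbert R H}.

Definition is_action (G : groupType) (X : Type) (a : G -> X -> X) :=
  (forall x, a 1%g x = x) /\ (forall g h x, a (g * h)%g x = a g (a h x)).

Section Representations.
Variables (R : realType) (G : topologicalGroupType).

(* Each [pi g] is bijective because [pi] is a group action. *)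
Record unitary_representation (H : hilbertType R) (pi : G -> H -> H) : Prop := {
  urep_action : is_action pi ;
  urep_linear : forall g, linear (pi g) ;
  urep_dot : forall g x y, hdot (pi g x) (pi g y) = hdot x y ;
  urep_continuous : forall x, continuous (pi ^~ x)
}.

Definition has_invariant_vector (K : set G) (H : hilbertType R)
    (pi : G -> H -> H) :=
  exists2 x : H, x != 0 & forall k, K k -> pi k x = x.

Definition vanishes_at_infinity (K : set G) (f : G -> R[i]) :=
  forall e : R, 0 < e -> exists C : set G,
    [/\ compact C, C `<=` K & forall k, (K `\` C) k -> `|f k| < e%:C%C].

Definition C0_representation (K : set G) (H : hilbertType R)
    (pi : G -> H -> H) :=
  forall x y, vanishes_at_infinity K (fun k => hdot (pi k x) y).

Definition relative_howe_moore (K : set G) :=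
  forall (H : hilbertType R) (pi : G -> H -> H), unitary_representation pi ->
    has_invariant_vector K pi \/ C0_representation K pi.

Definition howe_moore := relative_howe_moore [set: G].

End Representations.

(* The library provides [LspaceType] only as a bare type; the vector space   *)
(* structure and the norm are transported from [LfunType].                   *)
Section LspaceNormedModule.
Context d (T : measurableType d) (R : realType).
Variables (mu : {measure set T -> \bar R}) (p : \bar R) (p1 : (1 <= p)%E).
Local Notation Lf := (LfunType mu p1).
Local Notation Ls := (LspaceType mu p1).
Local Notation Rm := (measurableTypeR R).
Local Notation Q := {mfun_ mu, T >-> Rm}.

Definition Lfun_mfunR (f : Lf) : T -> Rm := f.

Lemma Lfun_mfunR_measurable f : measurable_fun [set: T] (Lfun_mfunR f).
Proof. by have : measurable_fun [set: T] f by []. Qed.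

HB.instance Definition _ f :=
  isMeasurableFun.Build _ _ _ _ (Lfun_mfunR f) (@Lfun_mfunR_measurable f).

Lemma measurable_poweR_abse (f : T -> R) r : measurable_fun [set: T] f ->
  measurable_fun [set: T] (fun x => (`|(EFin \o f) x| `^ r)%E : \bar R).
Proof.
move=> mf; apply: (measurableT_comp (measurable_poweR _)).
by apply: measurableT_comp => //; exact/measurable_EFinP.
Qed.

Lemma ae_eq_Lnorm (f g : T -> R) : measurable_fun [set: T] f ->
  measurable_fun [set: T] g -> f = g %[ae mu] ->
  'N[mu]_p[EFin \o f]%E = 'N[mu]_p[EFin \o g]%E.
Proof.
move=> mf mg fg; rewrite unlock; case: p p1 => [r r1||//] /=.
- congr (_ `^ _)%E; apply: ge0_ae_eq_integral => //=.
  + exact: measurable_poweR_abse.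
  + exact: measurable_poweR_abse.
  + by apply: (filterS _ fg) => x /= + _ => /(_ I) ->.
- move=> _; case: ifPn => // _.
  by apply: eq_ess_sup; apply: (filterS _ fg) => x /= /(_ I) ->.
Qed.

Definition Lspace_repr (f : Ls) : T -> R := repr (LebesgueSpace.sort f).

Lemma Lspace_repr_measurable f : measurable_fun [set: T] (Lspace_repr f).
Proof.
by have : measurable_fun [set: T] (repr (LebesgueSpace.sort f)) by [].
Qed.

Lemma Lspace_repr_Lfun f : Lspace_repr f \in Lfun mu p.
Proof.
rewrite inE; apply/andP; split; rewrite inE /=.
  exact: Lspace_repr_measurable.
exact: (@Lebesgue_finite _ _ _ _ _ _ f).
Qed.

Definition Lfun_of_Lspace (f : Ls) : Lf := Lfun_Sub p1 (Lspace_repr_Lfun f).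
Local Notation toL := Lfun_of_Lspace.

Definition Lfun_pi (f : Lf) : Q := \pi_Q%qT (Lfun_mfunR f : {mfun T >-> Rm}).

Lemma Lfun_pi_ae f : (repr (Lfun_pi f) : T -> R) = f %[ae mu].
Proof.
have /eqP : \pi_Q%qT (repr (Lfun_pi f)) =
    \pi_Q%qT (Lfun_mfunR f : {mfun T >-> Rm}).
  by rewrite reprK.
by rewrite eqmodE => /asboolP.
Qed.

Lemma Lfun_pi_finite f : finite_norm mu p (Lfun_pi f : T -> R).
Proof.
rewrite /finite_norm (ae_eq_Lnorm _ _ (Lfun_pi_ae f)) //.
- exact: Lfunction_finite.
- by have : measurable_fun [set: T] (repr (Lfun_pi f)) by [].
Qed.

Definition Lspace_of_Lfun (f : Lf) : Ls :=
  HB.pack_for Ls (Lfun_pi f)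
    (isFinLebesgue.Build _ _ _ _ _ p1 _ (Lfun_pi_finite f)).
Local Notation ofL := Lspace_of_Lfun.

Lemma Lspace_of_LfunK f : toL (ofL f) = f %[ae mu].
Proof. exact: Lfun_pi_ae. Qed.

Lemma Lspace_inj (f g : Ls) :
  LebesgueSpace.sort f = LebesgueSpace.sort g :> Q -> f = g.
Proof.
case: f g => [f [[f1]]] [g [[g1]]] /= fg; rewrite -{}fg in g1 *.
by rewrite (Prop_irrelevance f1 g1).
Qed.

Lemma eq_Lspace_of_Lfun (f g : Lf) : f = g %[ae mu] -> ofL f = ofL g.
Proof. by move=> fg; apply/Lspace_inj/eqmodP/asboolP. Qed.

Lemma Lfun_of_LspaceK : cancel toL ofL.
Proof.
move=> f; apply/Lspace_inj; rewrite -[RHS]reprK; apply/eqmodP/asboolP => /=.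
exact: nearW.
Qed.

Lemma Lspace_of_Lfun_inj (f g : Lf) : ofL f = ofL g -> f = g %[ae mu].
Proof.
move=> fg; have := Lspace_of_LfunK f; rewrite fg => gf.
move: gf (Lspace_of_LfunK g).
apply: filterS2 => x /= + + _.
by move=> /(_ I) -> /(_ I).
Qed.

HB.instance Definition _ := gen_eqMixin Ls.
HB.instance Definition _ := gen_choiceMixin Ls.

Definition Lspace_add (f g : Ls) : Ls := ofL (toL f + toL g).
Definition Lspace_opp (f : Ls) : Ls := ofL (- toL f).
Definition Lspace_scale (a : R) (f : Ls) : Ls := ofL (a *: toL f).

Lemma Lspace_addE (f g : Lf) : Lspace_add (ofL f) (ofL g) = ofL (f + g).
Proof.
apply/eq_Lspace_of_Lfun.
move: (Lspace_of_LfunK f) (Lspace_of_LfunK g); apply: filterS2 => x /= + + _.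
by rewrite !fctE => /(_ I) -> /(_ I) ->.
Qed.

Lemma Lspace_oppE (f : Lf) : Lspace_opp (ofL f) = ofL (- f).
Proof.
apply/eq_Lspace_of_Lfun.
by apply: (filterS _ (Lspace_of_LfunK f)) => x /= + _;
  rewrite !fctE => /(_ I) ->.
Qed.

Lemma Lspace_scaleE a (f : Lf) : Lspace_scale a (ofL f) = ofL (a *: f).
Proof.
apply/eq_Lspace_of_Lfun.
by apply: (filterS _ (Lspace_of_LfunK f)) => x /= + _;
  rewrite !fctE => /(_ I) ->.
Qed.

Lemma Lspace_addA : associative Lspace_add.
Proof.
move=> f g h; rewrite -[f]Lfun_of_LspaceK -[g]Lfun_of_LspaceK.
by rewrite -[h]Lfun_of_LspaceK !Lspace_addE addrA.
Qed.

Lemma Lspace_addC : commutative Lspace_add.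
Proof. by move=> f g; rewrite /Lspace_add addrC. Qed.

Lemma Lspace_add0 : left_id (ofL 0) Lspace_add.
Proof. by move=> f; rewrite -[f]Lfun_of_LspaceK Lspace_addE add0r. Qed.

Lemma Lspace_addN : left_inverse (ofL 0) Lspace_opp Lspace_add.
Proof.
by move=> f; rewrite -[f]Lfun_of_LspaceK Lspace_oppE Lspace_addE addNr.
Qed.

HB.instance Definition _ :=
  GRing.isZmodule.Build Ls Lspace_addA Lspace_addC Lspace_add0 Lspace_addN.

Lemma Lspace_of_Lfun0 : ofL 0 = 0. Proof. by []. Qed.

Lemma Lspace_of_LfunD (f g : Lf) : ofL (f + g) = ofL f + ofL g.
Proof. exact/esym/Lspace_addE. Qed.

Lemma Lspace_of_LfunN (f : Lf) : ofL (- f) = - ofL f.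
Proof. exact/esym/Lspace_oppE. Qed.

Lemma Lspace_scaleA a b (f : Ls) : Lspace_scale a (Lspace_scale b f) =
  Lspace_scale (a * b) f.
Proof. by rewrite -[f]Lfun_of_LspaceK !Lspace_scaleE scalerA. Qed.

Lemma Lspace_scale1 : left_id 1 Lspace_scale.
Proof. by move=> f; rewrite -[f]Lfun_of_LspaceK Lspace_scaleE scale1r. Qed.

Lemma Lspace_scaleDr : right_distributive Lspace_scale +%R.
Proof.
move=> a f g; rewrite -[f]Lfun_of_LspaceK -[g]Lfun_of_LspaceK.
by rewrite -Lspace_of_LfunD !Lspace_scaleE scalerDr Lspace_of_LfunD.
Qed.

Lemma Lspace_scaleDl f : {morph Lspace_scale^~ f : a b / a + b}.
Proof.
move=> a b; rewrite -[f]Lfun_of_LspaceK.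
by rewrite !Lspace_scaleE scalerDl Lspace_of_LfunD.
Qed.

HB.instance Definition _ :=
  GRing.Zmodule_isLmodule.Build R Ls Lspace_scaleA Lspace_scale1
    Lspace_scaleDr Lspace_scaleDl.

Lemma Lspace_of_LfunZ a (f : Lf) : ofL (a *: f) = a *: ofL f.
Proof. exact/esym/Lspace_scaleE. Qed.

Definition Lspace_norm (f : Ls) : R := fine 'N[mu]_p[EFin \o toL f].

Lemma Lspace_normE (f : Lf) : Lspace_norm (ofL f) = fine 'N[mu]_p[EFin \o f].
Proof. by congr fine; apply: ae_eq_Lnorm => //; exact: Lspace_of_LfunK. Qed.

Lemma ler_Lspace_normD f g :
  Lspace_norm (f + g) <= Lspace_norm f + Lspace_norm g.
Proof.
rewrite -[f]Lfun_of_LspaceK -[g]Lfun_of_LspaceK -Lspace_of_LfunD.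
by rewrite !Lspace_normE; exact: ler_LnormD.
Qed.

Lemma Lspace_normZ a f : Lspace_norm (a *: f) = `|a| * Lspace_norm f.
Proof.
rewrite -[f]Lfun_of_LspaceK -Lspace_of_LfunZ !Lspace_normE.
by rewrite [X in fine X]LnormZ -finite_norm_fine.
Qed.

Lemma Lspace_norm0_eq0 f : Lspace_norm f = 0 -> f = 0.
Proof.
rewrite -[f]Lfun_of_LspaceK Lspace_normE => /fine_Lnormr_eq0 f0.
by apply: (@eq_Lspace_of_Lfun _ 0); apply: filterS f0 => x.
Qed.

HB.instance Definition _ := @Lmodule_isNormed.Build R Ls
  Lspace_norm ler_Lspace_normD Lspace_normZ Lspace_norm0_eq0.

End LspaceNormedModule.

Section AffineIsometricActions.
Variables (R : realType) (G : topologicalGroupType).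

Record affine_isometric_action (V : normedModType R) (a : G -> V -> V) :
    Prop := {
  aia_action : is_action a ;
  aia_affine : forall g (t : R) x y,
    a g (t *: x + (1 - t) *: y) = t *: a g x + (1 - t) *: a g y ;
  aia_isometric : forall g x y, `|a g x - a g y| = `|x - y| ;
  aia_continuous : continuous (fun gx : G * V => a gx.1 gx.2)
}.

Definition bounded_action (V : normedModType R) (a : G -> V -> V) :=
  forall x, bounded_set (range (a ^~ x)).

Definition proper_action (V : normedModType R) (a : G -> V -> V) :=
  forall x (r : R), precompact [set g | `|a g x - x| <= r].

(* [LspaceType2 mu] consists of real-valued functions. A complex L^2-space is  *)
(* isometric, as a real normed space, to the real L^2-space of the disjoint    *)
(* union of two copies of the measure space.                                   *)
Definition BP_L2 :=
  forall d (T : measurableType d) (mu : {measure set T -> \bar R})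
    (a : G -> LspaceType2 mu -> LspaceType2 mu),
  affine_isometric_action a -> bounded_action a \/ proper_action a.

End AffineIsometricActions.

Arguments relative_howe_moore R {G} K.

(* Main.v *)
Require Import Defs.
From HB Require Import structures.
From mathcomp Require Import all_boot all_order all_algebra.
From mathcomp Require Import sesquilinear complex ring lra.
From mathcomp Require Import all_classical all_reals all_analysis.
From mathcomp Require Import measurable_realfun.

(** For a real Hilbert space V, the Gaussian kernel exp(-|v - w|^2) is positive
    semidefinite ([psd_gauss]), so there is a Hilbert space spanned by vectors
    e_v, for v in V, with <e_v, e_w> = exp(-|v - w|^2). The kernel only depends
    on distances: an affine isometric action of G on V permutes the e_v, and
    this extends to a unitary representation pi of G, for which
      <pi(g) e_v, e_v> = exp(-|g v - v|^2).
    Hence pi restricted to a subgroup N is C_0 only if N acts properly on V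
    ([C0_rep_proper]).

    Invariant vectors are excluded by unbounded orbits. A vector f is determined
    by the function f(v) = <f, e_v> on V, and this function tends to 0 as |v|
    tends to infinity, because it does so for f = e_w and the e_w have dense
    span ([rkhs_vanishes]). If f is N-invariant then f(v) = f(n v) for n in N;
    when n v is unbounded, f(v) = 0 ([unbounded_no_invariant_vector]). So under
    the relative Howe-Moore property either N has a bounded orbit, or N acts
    properly. As N is cocompact, G = C N for some compact C
    ([cocompact_transversal]); the points of C move a given vector by a bounded
    amount, so both alternatives pass from N to G
    ([howe_moore_bounded_or_proper]). For a Howe-Moore group, take N = G and
    C = {1}.

    The Hilbert space is realized as a space of functions on V. A function f
    defines a linear form on the formal combinations s of points of V, which
    carry the seminorm |s| coming from the kernel, and f belongs to the space
    when this form is bounded; its squared norm is the supremum over s of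
    2 f(s) - |s|^2. From this formula, substitutions in s give the parallelogram
    law ([rk_parallelogram]) and the density of the finite combinations
    ([rk_comb_dense]), and completeness holds because norm bounds pass to
    pointwise limits ([rkhs_complete]). The Jordan-von Neumann theorem turns the
    parallelogram law into a scalar product, here and for L^2 itself, and the
    resulting real Hilbert space is complexified ([cplx]). *)

Set Implicit Arguments.
Unset Strict Implicit.
Unset Printing Implicit Defensive.

Import Order.TTheory GRing.Theory Num.Def Num.Theory.
Import numFieldNormedType.Exports.

Local Open Scope classical_set_scope.
Local Open Scope ring_scope.

(** * The scalar product of a norm satisfying the parallelogram law *)

(** The additive map A t - t A 1 vanishes at 1, so it is bounded on the
    positive half-line; being additive, it is then 0. *)
Lemma additive_locally_bounded_linear (R : realType) (A : R -> R) (M : R) :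
  (forall s t, A (s + t) = A s + A t) ->
  (forall t, `|t| <= 1 -> `|A t| <= M) ->
  forall t, A t = t * A 1.
Proof.
move=> AD AM.
pose B t := A t - t * A 1.
have BD s t : B (s + t) = B s + B t by rewrite /B AD; ring.
have B0 : B 0 = 0 by have := BD 0 0; rewrite addr0; lra.
have BMn t n : B (t *+ n) = B t *+ n.
  by elim: n => [|n IH]; rewrite ?mulr0n ?B0// !mulrS BD IH.
have B1 : B 1 = 0 by rewrite /B; ring.
(* B has period 1, hence is bounded on the whole half-line. *)
have Bbounded t : 0 <= t -> `|B t| <= M + `|A 1|.
  move=> t0; have /andP[lt ut] := truncn_itv t0.
  have -> : B t = B (t - (Num.truncn t)%:R).
    rewrite -[in LHS](subrK ((Num.truncn t)%:R) t) BD.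
    by rewrite [B _%:R]BMn B1 mul0rn addr0.
  set r := t - _.
  have r0 : 0 <= r by rewrite subr_ge0.
  have r1 : r <= 1 by rewrite lerBlDr -natr1 addrC in ut *; apply: ltW.
  rewrite (le_trans (ler_normB _ _))// lerD//; first by rewrite AM// ger0_norm.
  by rewrite normrM ler_piMl// ger0_norm.
have Bpos t : 0 <= t -> B t = 0.
  move=> t0; apply/eqP; rewrite -normr_eq0; apply: contraT => Bt.
  have Bt0 : 0 < `|B t| by rewrite lt_def Bt normr_ge0.
  have M0 := le_trans (normr_ge0 _) (Bbounded t t0).
  have := archi_boundP (divr_ge0 M0 (ltW Bt0)).
  set n := Num.bound _; rewrite ltr_pdivrMr//.
  move=> /(le_lt_trans (Bbounded (t *+ n) _)).
  by rewrite BMn normrMn mulr_natl ltxx => /(_ (mulrn_wge0 n t0)).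
move=> t; apply/eqP; rewrite -subr_eq0; apply/eqP; rewrite -/(B t).
have [/Bpos//|/ltW t0] := leP 0 t.
have := BD t (- t); rewrite subrr B0 [B (- t)]Bpos ?oppr_ge0// addr0.
by move=> <-.
Qed.

Section ParallelogramLaw.
Variables (R : realType) (V : normedModType R).

Definition parallelogram_law :=
  forall x y : V, `|x + y| ^+ 2 + `|x - y| ^+ 2 = 2 * (`|x| ^+ 2 + `|y| ^+ 2).

Definition polar (x y : V) : R := (`|x + y| ^+ 2 - `|x - y| ^+ 2) / 4.

Lemma polarC x y : polar x y = polar y x.
Proof. by rewrite /polar [x + y]addrC distrC. Qed.

Lemma polarxx x : polar x x = `|x| ^+ 2.
Proof.
rewrite /polar subrr normr0 -[x + x]mulr2n -scaler_nat normrZ ger0_norm//.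
by field.
Qed.

Hypothesis para : parallelogram_law.

Lemma sqr_normD x y : `|x + y| ^+ 2 = `|x| ^+ 2 + `|y| ^+ 2 + 2 * polar x y.
Proof. by rewrite /polar; have := para x y; lra. Qed.

Lemma sqr_normB x y : `|x - y| ^+ 2 = `|x| ^+ 2 + `|y| ^+ 2 - 2 * polar x y.
Proof. by rewrite /polar; have := para x y; lra. Qed.

Let polar0l y : polar 0 y = 0.
Proof. by rewrite /polar add0r sub0r normrN subrr mul0r. Qed.

Let polar_mid x h y : polar (x + h) y + polar (x - h) y = 2 * polar x y.
Proof.
have := para (x + y) h; have := para (x - y) h; rewrite /polar.
rewrite [x + y + h]addrAC [x + y - h]addrAC [x - y + h]addrAC [x - y - h]addrAC.
lra.
Qed.

(** Jordan-von Neumann: [polar_mid], applied to half the sum and half the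
    difference of x and x', is additivity. *)
Lemma polarDl x x' y : polar (x + x') y = polar x y + polar x' y.
Proof.
have half (u : V) : u = 2^-1 *: u + 2^-1 *: u.
  by rewrite -scalerDl [_ + _](_ : _ = 1) ?scale1r//; field.
have dbl z : 2 * polar (2^-1 *: z) y = polar z y.
  by rewrite -(polar_mid _ (2^-1 *: z)) subrr polar0l addr0 -half.
have ex : x = 2^-1 *: (x + x') + 2^-1 *: (x - x').
  by rewrite -scalerDr addrACA subrr addr0 scalerDr -half.
have ex' : x' = 2^-1 *: (x + x') - 2^-1 *: (x - x').
  by rewrite -scalerBr opprB [x + x']addrC addrACA subrr addr0 scalerDr -half.
by rewrite -dbl -(polar_mid _ (2^-1 *: (x - x'))) -ex -ex'.
Qed.

(** In the scalar, [polar] is additive by [polarDl], and bounded near 0 by the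
    parallelogram law. *)
Lemma polarZl a x y : polar (a *: x) y = a * polar x y.
Proof.
rewrite (@additive_locally_bounded_linear R (fun t => polar (t *: x) y)
  ((`|x| ^+ 2 + `|y| ^+ 2) / 2)); first by rewrite scale1r.
- by move=> s t; rewrite scalerDl polarDl.
move=> t t1; have tx : `|t *: x| ^+ 2 <= `|x| ^+ 2.
  by rewrite normrZ exprMn ler_piMl ?sqr_ge0// exprn_ile1.
have := sqr_ge0 `|t *: x + y|; have := sqr_ge0 `|t *: x - y|.
have := para (t *: x) y; rewrite /polar ler_norml; lra.
Qed.

Lemma polarNl x y : polar (- x) y = - polar x y.
Proof. by rewrite -scaleN1r polarZl mulN1r. Qed.

Lemma polarDr x y y' : polar x (y + y') = polar x y + polar x y'.
Proof. by rewrite polarC polarDl !(polarC _ x). Qed.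

Lemma polarZr a x y : polar x (a *: y) = a * polar x y.
Proof. by rewrite polarC polarZl polarC. Qed.

End ParallelogramLaw.

(** * Square-integrable functions *)

Section L2.
Context d (T : measurableType d) (R : realType).
Variable mu : {measure set T -> \bar R}.

Lemma sqr_Lspace_norm (f : LfunType mu (lee1n 2)) :
  ((`|Lspace_of_Lfun f| ^+ 2)%:E = \int[mu]_x ((f x) ^+ 2)%:E)%E.
Proof.
have -> : `|Lspace_of_Lfun f| = fine 'N[mu]_2%:E[EFin \o f].
  exact: Lspace_normE.
rewrite EFin_expe finite_norm_fine.
have <- : ('N[mu]_2%:E[EFin \o f] `^ 2 = 'N[mu]_2%:E[EFin \o f] ^+ 2)%E.
  rewrite -finite_norm_fine poweR_EFin powR_mulrn ?EFin_expe//.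
  by rewrite fine_ge0// Lnorm_ge0.
rewrite poweR_Lnorm//; apply: eq_integral => x _ /=.
by rewrite powR_mulrn// real_normK ?num_real.
Qed.

Lemma L2_parallelogram : parallelogram_law (LspaceType2 mu).
Proof.
move=> u v; rewrite -[u]Lfun_of_LspaceK -[v]Lfun_of_LspaceK.
move: (Lfun_of_Lspace u) (Lfun_of_Lspace v) => {u v} f g.
rewrite -Lspace_of_LfunN -!Lspace_of_LfunD.
have mf : measurable_fun [set: T] f by [].
have mg : measurable_fun [set: T] g by [].
pose n2 (h : LfunType mu (lee1n 2)) := `|Lspace_of_Lfun h| ^+ 2.
have n2E h : ((n2 h)%:E = \int[mu]_x ((h x) ^+ 2)%:E)%E := sqr_Lspace_norm h.
change (n2 (f + g) + n2 (f - g) = 2 * (n2 f + n2 g)); clearbody n2.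
have msq (h : T -> R) : measurable_fun [set: T] h ->
    measurable_fun [set: T] (fun x => ((h x) ^+ 2)%:E : \bar R).
  by move=> mh; apply/measurable_EFinP; exact: measurable_funX.
have sq0 (a : R) : (0 <= (a ^+ 2)%:E)%E by rewrite lee_fin sqr_ge0.
apply: EFin_inj; rewrite EFinD EFinM (EFinD (n2 f)) !n2E.
rewrite -!ge0_integralD//; [|exact: msq..].
rewrite -ge0_integralZl_EFin//; [|by move=> x _; rewrite adde_ge0|].
  apply: eq_integral => x _; rewrite -!EFinD -EFinM; congr EFin.
  rewrite -[(f + g) x]/(f x + g x) -[(f - g) x]/(f x - g x); ring.
by apply: emeasurable_funD; exact: msq.
Qed.

End L2.

Arguments L2_parallelogram {d T R} mu.

(** * Formal linear combinations and positive semidefinite kernels *)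

Section FormalCombinations.
Variables (R : realType) (X : Type).
Implicit Types (f g : X -> R) (s t : seq (R * X)) (a : R).

(** A list of pairs (c, x) stands for the formal combination of the points x
    with coefficients c; concatenation is the sum. *)
Definition eval_comb f s : R := \sum_(p <- s) p.1 * f p.2.

Definition scale_comb a s : seq (R * X) := [seq (a * p.1, p.2) | p <- s].

Lemma eval_comb_cat f s t :
  eval_comb f (s ++ t) = eval_comb f s + eval_comb f t.
Proof. by rewrite /eval_comb big_cat. Qed.

Lemma eval_comb_scale f a s : eval_comb f (scale_comb a s) = a * eval_comb f s.
Proof.
by rewrite /eval_comb big_map mulr_sumr; apply: eq_bigr => p _; rewrite mulrA.
Qed.

Lemma eval_combD f g s : eval_comb (f \+ g) s = eval_comb f s + eval_comb g s.
Proof.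
by rewrite /eval_comb -big_split; apply: eq_bigr => p _; rewrite mulrDr.
Qed.

Lemma eval_combZ a f s : eval_comb (fun x => a * f x) s = a * eval_comb f s.
Proof.
by rewrite /eval_comb mulr_sumr; apply: eq_bigr => p _; rewrite mulrCA.
Qed.

Lemma eval_comb1 f x : eval_comb f [:: (1, x)] = f x.
Proof. by rewrite /eval_comb big_seq1 mul1r. Qed.

Lemma eval_comb_nil f : eval_comb f [::] = 0.
Proof. by rewrite /eval_comb big_nil. Qed.

Section Kernel.
Variable k : X -> X -> R.

(** The element of the reproducing kernel space represented by the formal
    combination s. *)
Definition kernel_comb s : X -> R := fun x => eval_comb (k ^~ x) s.

(** The squared seminorm of the formal combination s. *)
Definition sqr_comb s : R := eval_comb (kernel_comb s) s.

Definition psd := (forall x y, k x y = k y x) /\ (forall s, 0 <= sqr_comb s).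

Lemma eval_kernel_comb_sum s t : eval_comb (kernel_comb s) t =
  \sum_(p <- s) \sum_(q <- t) p.1 * q.1 * k p.2 q.2.
Proof.
rewrite exchange_big; apply: eq_bigr => q _; rewrite mulr_sumr.
by apply: eq_bigr => p _; rewrite mulrCA mulrA.
Qed.

Lemma sqr_comb_ge0 s : psd -> 0 <= sqr_comb s.
Proof. by case=> _; exact. Qed.

Hypothesis kC : forall x y, k x y = k y x.

Lemma eval_kernel_combC s t :
  eval_comb (kernel_comb s) t = eval_comb (kernel_comb t) s.
Proof.
rewrite !eval_kernel_comb_sum exchange_big; apply: eq_bigr => q _.
by apply: eq_bigr => p _; rewrite kC [p.1 * _]mulrC.
Qed.

Lemma sqr_comb_cat s t : sqr_comb (s ++ t) =
  sqr_comb s + sqr_comb t + 2 * eval_comb (kernel_comb s) t.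
Proof.
have E u : eval_comb (kernel_comb (s ++ t)) u =
    eval_comb (kernel_comb s) u + eval_comb (kernel_comb t) u.
  rewrite -eval_combD; apply: eq_bigr => p _.
  by rewrite /kernel_comb eval_comb_cat.
rewrite /sqr_comb eval_comb_cat !E (eval_kernel_combC t s); ring.
Qed.

Lemma eval_kernel_comb_scale a s t :
  eval_comb (kernel_comb (scale_comb a s)) t = a * eval_comb (kernel_comb s) t.
Proof.
rewrite -eval_combZ; apply: eq_bigr => p _.
by rewrite /kernel_comb eval_comb_scale.
Qed.

Lemma sqr_comb_scale a s : sqr_comb (scale_comb a s) = a ^+ 2 * sqr_comb s.
Proof.
by rewrite /sqr_comb eval_comb_scale eval_kernel_comb_scale mulrA expr2.
Qed.

End Kernel.
End FormalCombinations.

Record psdKernel (R : realType) (X : Type) := PsdKernel {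
  kern :> X -> X -> R ;
  kernP : psd kern
}.

(** * The real reproducing kernel Hilbert space *)

Section ReproducingKernel.
Variables (R : realType) (X : Type) (k : psdKernel R X).
Implicit Types (f g : X -> R) (s t : seq (R * X)) (a M : R).
Local Notation sqk := (sqr_comb k).
Let kpsd : psd k := kernP k.
Let kC : forall x y, k x y = k y x := kpsd.1.

(** This says that f, as a linear form on formal combinations, has squared norm
    at most M. The inhomogeneous form makes the substitutions s + t in the
    variable effective. *)
Definition rk_bound f M := forall s, 2 * eval_comb f s - sqk s <= M.

(** The equivalence with the usual Cauchy-Schwarz bound: replace s by t s and
    optimize over t. *)
Lemma rk_boundP f M : rk_bound f M <->
  0 <= M /\ forall s, eval_comb f s ^+ 2 <= M * sqk s.
Proof.
split=> [fM|[M0 fM] s].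
  have M0 : 0 <= M.
    have := fM [::]; rewrite /sqr_comb !eval_comb_nil; lra.
  split=> // s.
  have H (t : R) : 2 * (t * eval_comb f s) - t ^+ 2 * sqk s <= M.
    by rewrite -eval_comb_scale -sqr_comb_scale.
  have := sqr_comb_ge0 s kpsd; rewrite le_eqVlt => /predU1P[a0|a0].
    move: H; rewrite -a0 mulr0 => H.
    have [->|b0] := eqVneq (eval_comb f s) 0; first by rewrite expr0n.
    have := H ((M + 1) / 2 / eval_comb f s).
    by rewrite mulfVK//; lra.
  have := H (eval_comb f s / sqk s).
  set b := eval_comb _ _; set c := sqk s in a0 *.
  have -> : 2 * (b / c * b) - (b / c) ^+ 2 * c = b ^+ 2 / c.
    by field; exact: lt0r_neq0.
  by rewrite ler_pdivrMr.
have := fM s; have := sqr_comb_ge0 s kpsd.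
set b := eval_comb _ _; set c := sqk s => c0 bc.
rewrite lerBlDr; case: (leP 0 b) => b0; last by lra.
rewrite -(@ler_pXn2r _ 2) ?nnegrE ?addr_ge0 ?mulr_ge0//.
by have := sqr_ge0 (M - c); nra.
Qed.

Definition rk_pred : {pred X -> R} := fun f => `[< exists M, rk_bound f M >].

Lemma rk_submod_closed : submod_closed rk_pred.
Proof.
split.
  apply/asboolP; exists 0 => s.
  rewrite [eval_comb _ _]big1 ?mulr0 ?sub0r ?oppr_le0 ?sqr_comb_ge0// => p _.
  by rewrite mulr0.
move=> a f g /asboolP[M /rk_boundP[M0 fM]] /asboolP[M' /rk_boundP[M0' gM]].
apply/asboolP; exists (2 * (a ^+ 2 * M) + 2 * M'); apply/rk_boundP; split.
  by have := mulr_ge0 (sqr_ge0 a) M0; lra.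
move=> s; rewrite -[a *: f + g]/((fun x => a * f x) \+ g) eval_combD eval_combZ.
have := fM s; have := gM s.
set b := eval_comb _ _; set c := eval_comb _ _ => h1 h2.
have := sqr_ge0 (a * c - b); have : 0 <= a ^+ 2 * (M * sqk s - c ^+ 2).
  by rewrite mulr_ge0 ?sqr_ge0// subr_ge0.
nra.
Qed.

HB.instance Definition _ := GRing.isSubmodClosed.Build R (X -> R) rk_pred
  rk_submod_closed.

Record rkhs := Rkhs { rk_fun :> X -> R; rk_funP : rk_fun \in rk_pred }.

HB.instance Definition _ := [isSub for rk_fun].
HB.instance Definition _ := [Choice of rkhs by <:].
HB.instance Definition _ := [SubChoice_isSubLmodule of rkhs by <:].

Implicit Types (F : rkhs).

(** The squared norm of f as a linear form: the maximum over t of 2 b t - c t^2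
    is b^2 / c. *)
Definition rk_sqrnorm f : R := sup [set 2 * eval_comb f s - sqk s | s in setT].

Lemma rk_sqrnorm_bound F : rk_bound F (rk_sqrnorm F).
Proof.
move=> s; apply: ub_le_sup; last by exists s.
have /asboolP[M FM] := rk_funP F.
by exists M => _ [t _ <-]; exact: FM.
Qed.

Lemma rk_sqrnorm_le f M : rk_bound f M -> rk_sqrnorm f <= M.
Proof.
move=> fM; apply: ge_sup.
  by exists (2 * eval_comb f [::] - sqk [::]), [::].
by move=> _ [t _ <-]; exact: fM.
Qed.

Lemma rk_sqrnorm_ge0 F : 0 <= rk_sqrnorm F.
Proof. by have /rk_boundP[] := rk_sqrnorm_bound F. Qed.

Lemma eval_comb_sqr_le F s : eval_comb F s ^+ 2 <= rk_sqrnorm F * sqk s.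
Proof. by have /rk_boundP[_] := rk_sqrnorm_bound F. Qed.

Lemma rk_eval_comb_le F s :
  eval_comb F s <= Num.sqrt (rk_sqrnorm F) * Num.sqrt (sqk s).
Proof.
rewrite -sqrtrM ?rk_sqrnorm_ge0// (le_trans (ler_norm _))// -sqrtr_sqr.
by rewrite ler_sqrt ?eval_comb_sqr_le// mulr_ge0 ?rk_sqrnorm_ge0 ?sqr_comb_ge0.
Qed.

Let rk_sqrnormZ_le a F : rk_sqrnorm (a *: F : rkhs) <= a ^+ 2 * rk_sqrnorm F.
Proof.
apply: rk_sqrnorm_le => s.
rewrite [eval_comb _ _](_ : _ = a * eval_comb F s); last exact: eval_combZ.
have [->|a0] := eqVneq a 0.
  by rewrite mul0r mulr0 expr0n mul0r sub0r oppr_le0 sqr_comb_ge0.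
have := rk_sqrnorm_bound F (scale_comb a^-1 s).
rewrite eval_comb_scale sqr_comb_scale => /(ler_wpM2l (sqr_ge0 a)).
set b := eval_comb _ _; set c := sqk s.
suff -> : a ^+ 2 * (2 * (a^-1 * b) - a^-1 ^+ 2 * c) = 2 * (a * b) - c by [].
by field.
Qed.

Lemma rk_sqrnormZ a F : rk_sqrnorm (a *: F : rkhs) = a ^+ 2 * rk_sqrnorm F.
Proof.
apply/le_anti; rewrite rk_sqrnormZ_le andTb.
have [->|a0] := eqVneq a 0; first by rewrite expr0n mul0r rk_sqrnorm_ge0.
have := rk_sqrnormZ_le a^-1 (a *: F).
rewrite scalerA mulVf// scale1r exprVn ler_pdivlMl//.
by rewrite exprn_even_gt0.
Qed.

Definition rk_norm F := Num.sqrt (rk_sqrnorm F).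

Let rk_normD F G : rk_norm (F + G) <= rk_norm F + rk_norm G.
Proof.
have n0 : 0 <= rk_norm F + rk_norm G by rewrite addr_ge0 ?sqrtr_ge0.
rewrite -[leRHS]ger0_norm// -sqrtr_sqr ler_sqrt ?sqr_ge0//.
apply: rk_sqrnorm_le => s.
rewrite [eval_comb _ _](_ : _ = eval_comb F s + eval_comb G s);
  last exact: eval_combD.
have := rk_eval_comb_le F s; have := rk_eval_comb_le G s.
rewrite -/(rk_norm F) -/(rk_norm G) -(sqr_sqrtr (sqr_comb_ge0 s kpsd)).
rewrite sqrtr_sqr ger0_norm ?sqrtr_ge0//.
set r := Num.sqrt (sqk s) => h1 h2.
have := sqr_ge0 (rk_norm F + rk_norm G - r); nra.
Qed.

Let rk_normZ a F : rk_norm (a *: F) = `|a| * rk_norm F.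
Proof. by rewrite /rk_norm rk_sqrnormZ sqrtrM ?sqr_ge0// sqrtr_sqr. Qed.

Let rk_norm0_eq0 F : rk_norm F = 0 -> F = 0.
Proof.
move=> /eqP; rewrite sqrtr_eq0 => F0; apply/val_inj/funext => x.
have := eval_comb_sqr_le F [:: (1, x)]; rewrite eval_comb1.
have -> : rk_sqrnorm F = 0 by apply/le_anti; rewrite F0 rk_sqrnorm_ge0.
by rewrite mul0r exprn_even_le0//= => /eqP.
Qed.

HB.instance Definition _ := @Lmodule_isNormed.Build R rkhs
  rk_norm rk_normD rk_normZ rk_norm0_eq0.

Lemma sqr_rk_norm F : `|F| ^+ 2 = rk_sqrnorm F.
Proof. by rewrite -[`|F|]/(rk_norm F) sqr_sqrtr ?rk_sqrnorm_ge0. Qed.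

Lemma rk_norm_le F M : 0 <= M -> rk_bound F (M ^+ 2) -> `|F| <= M.
Proof.
by move=> M0 FM; rewrite -(@ler_pXn2r _ 2) ?nnegrE// sqr_rk_norm rk_sqrnorm_le.
Qed.

Lemma rk_eval_le F x : `|F x| <= `|F| * Num.sqrt (k x x).
Proof.
rewrite -[`|F|]/(Num.sqrt _) -sqrtrM ?rk_sqrnorm_ge0// -sqrtr_sqr.
have := eval_comb_sqr_le F [:: (1, x)]; rewrite eval_comb1.
rewrite /sqr_comb eval_comb1 /kernel_comb eval_comb1 => Fx.
by rewrite ler_sqrt// (le_trans (sqr_ge0 (F x))).
Qed.

(** For the terms of index s and t in the suprema on the left, put
    u = (s + t) / 2 and w = (s - t) / 2: their sum is twice the term of index u for F plus
    twice the term of index w for G. The opposite inequality is the same one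
    for F + G and F - G. *)
Lemma rk_parallelogram : parallelogram_law rkhs.
Proof.
have half F G : rk_sqrnorm (F + G : rkhs) + rk_sqrnorm (F - G : rkhs) <=
    2 * (rk_sqrnorm F + rk_sqrnorm G).
  rewrite -lerBrDr; apply: rk_sqrnorm_le => s.
  rewrite lerBrDr addrC -lerBrDr; apply: rk_sqrnorm_le => t.
  rewrite lerBrDr.
  pose u := scale_comb 2^-1 (s ++ t).
  pose w := scale_comb 2^-1 (s ++ scale_comb (- 1) t).
  have := rk_sqrnorm_bound F u; have := rk_sqrnorm_bound G w.
  rewrite /u /w !eval_comb_scale !sqr_comb_scale//.
  rewrite !eval_comb_cat !sqr_comb_cat//.
  rewrite !eval_comb_scale sqr_comb_scale//.
  rewrite [eval_comb (F + G : rkhs) _](_ : _ = eval_comb F s + eval_comb G s);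
    last exact: eval_combD.
  rewrite [eval_comb (F - G : rkhs) _](_ : _ = eval_comb F t - eval_comb G t).
    by lra.
  rewrite /eval_comb -sumrB; apply: eq_bigr => p _; by rewrite -mulrBr.
move=> F G; rewrite !sqr_rk_norm; apply/le_anti; rewrite half andTb.
have := half (F + G) (F - G).
have -> : F + G + (F - G) = 2 *: F by rewrite addrACA subrr addr0 scaler_nat.
have -> : F + G - (F - G) = 2 *: G.
  by rewrite opprB [F + G]addrC addrACA subrr addr0 scaler_nat.
rewrite !rk_sqrnormZ; lra.
Qed.

Let kernel_combP s : kernel_comb k s \in rk_pred.
Proof.
apply/asboolP; exists (sqk s) => t.
have := sqr_comb_ge0 (s ++ scale_comb (-1) t) kpsd.
rewrite sqr_comb_cat// sqr_comb_scale// eval_comb_scale; lra.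
Qed.

Definition rk_comb s : rkhs := Rkhs (kernel_combP s).

Definition rk_sect x : rkhs := rk_comb [:: (1, x)].

Lemma rk_sectE x y : rk_sect x y = k x y.
Proof. exact: eval_comb1. Qed.

Lemma rk_comb_cons a x s : rk_comb ((a, x) :: s) = a *: rk_sect x + rk_comb s.
Proof.
apply/val_inj/funext => y /=.
rewrite /kernel_comb /eval_comb big_cons /=; congr +%R.
rewrite -[RHS]/(a * rk_sect x y); by rewrite rk_sectE.
Qed.

Lemma rk_comb_nil : rk_comb [::] = 0.
Proof. by apply/val_inj/funext => y; exact: eval_comb_nil. Qed.

(** The term of index t for F - s is the term of index t + s for F, up to the
    constant 2 F(s) - |s|^2. *)
Lemma rk_sqrnorm_sub_comb F s :
  rk_sqrnorm (F - rk_comb s : rkhs) <=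
  rk_sqrnorm F - (2 * eval_comb F s - sqk s).
Proof.
apply: rk_sqrnorm_le => t.
have := rk_sqrnorm_bound F (t ++ s); rewrite eval_comb_cat sqr_comb_cat//.
rewrite [eval_comb (F - _ : rkhs) _](_ : _ =
  eval_comb F t - eval_comb (rk_comb s) t).
  rewrite /= (eval_kernel_combC _ s)//; lra.
by rewrite /eval_comb -sumrB; apply: eq_bigr => p _; rewrite -mulrBr.
Qed.

(** By [rk_sqrnorm_sub_comb], combinations nearly attaining the supremum that
    defines the norm of F are close to F. *)
Lemma rk_comb_dense F (e : R) : 0 < e -> exists s, `|F - rk_comb s| < e.
Proof.
move=> e0.
have hs : has_sup [set 2 * eval_comb F s - sqk s | s in setT].
  split; first by exists (2 * eval_comb F [::] - sqk [::]), [::].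
  by exists (rk_sqrnorm F) => _ [t _ <-]; exact: rk_sqrnorm_bound.
have [_ [s _ <-] hse] := sup_adherent (exprn_gt0 2 e0) hs.
exists s; rewrite -(@ltr_pXn2r _ 2) ?nnegrE ?normr_ge0 ?(ltW e0)// sqr_rk_norm.
rewrite (le_lt_trans (rk_sqrnorm_sub_comb F s))//.
by move: hse; rewrite -/(rk_sqrnorm F); lra.
Qed.

Lemma sqr_rk_norm_comb s : `|rk_comb s| ^+ 2 = sqk s.
Proof.
rewrite sqr_rk_norm; apply/le_anti/andP; split.
  apply: rk_sqrnorm_le => t; have := sqr_comb_ge0 (s ++ scale_comb (-1) t) kpsd.
  rewrite sqr_comb_cat// sqr_comb_scale// eval_comb_scale; lra.
have := rk_sqrnorm_bound (rk_comb s) s; rewrite -/(sqk s); lra.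
Qed.

(** The reproducing property of the vectors e_x = k x. *)
Lemma polar_rk_sect x y : polar (rk_sect x) (rk_sect y) = k x y.
Proof.
have sq z : `|rk_sect z| ^+ 2 = k z z.
  rewrite sqr_rk_norm_comb /sqr_comb eval_comb1; exact: eval_comb1.
have := sqr_normB rk_parallelogram (rk_sect x) (rk_sect y).
have -> : rk_sect x - rk_sect y = rk_comb [:: (1, x); (-1, y)].
  by rewrite !rk_comb_cons rk_comb_nil scale1r scaleN1r addr0.
rewrite !sq sqr_rk_norm_comb /sqr_comb eval_kernel_comb_sum.
rewrite !big_cons !big_nil /=.
rewrite (kC y x); lra.
Qed.

(** The pointwise limit of a Cauchy filter is its norm limit: each inequality in
    [rk_bound] passes to pointwise limits. *)
Lemma rkhs_complete (A : set_system rkhs) :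
  ProperFilter A -> cauchy A -> cvg A.
Proof.
move=> AA Acauchy.
have Aball (e : R) : 0 < e -> exists F0, A [set F | `|F0 - F| < e].
  move=> e0; have /cauchyP/(_ _ e0)[F0 AF0] := Acauchy.
  by exists F0; move: AF0; rewrite -ball_normE.
have Apt x : cvg ((fun F : rkhs => F x) @ A).
  apply/cauchy_cvgP/cauchyP => e e0.
  pose m := Num.sqrt (k x x) + 1.
  have m0 : 0 < m by rewrite ltr_wpDl ?sqrtr_ge0.
  have [F0 AF0] := Aball (e / m) (divr_gt0 e0 m0).
  exists (F0 x); rewrite /fmap/=; apply: (@filterS _ A _ _ _ _ AF0) => F /= AF.
  rewrite -ball_normE /=.
  have := rk_eval_le (F0 - F) x => /le_lt_trans; apply.
  apply: le_lt_trans (_ : `|F0 - F| * m < e).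
    by rewrite ler_wpM2l// lerDl.
  by rewrite -ltr_pdivlMr.
pose f : X -> R := fun x => lim ((fun F : rkhs => F x) @ A).
have fcvg s : (fun F : rkhs => eval_comb F s) @ A --> eval_comb f s.
  elim: s => [|p s IH].
    have E (g : X -> R) : eval_comb g [::] = 0 by exact: eval_comb_nil.
    rewrite E; under eq_fun do rewrite E; exact: cvg_cst.
  have E (g : X -> R) : eval_comb g (p :: s) = p.1 * g p.2 + eval_comb g s.
    by rewrite /eval_comb big_cons.
  rewrite E; under eq_fun do rewrite E.
  by apply: cvgD IH; apply: cvgMr; exact: Apt.
have fnear (e : R) : 0 < e -> exists2 F0 : rkhs,
    A [set F | `|F0 - F| < e] & rk_bound (fun x => F0 x - f x) (e ^+ 2).
  move=> e0; have [F0 AF0] := Aball e e0; exists F0 => // s.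
  have E (g : X -> R) : eval_comb (fun x => F0 x - g x) s =
      eval_comb F0 s - eval_comb g s.
    by rewrite /eval_comb -sumrB; apply: eq_bigr => p _; rewrite -mulrBr.
  rewrite E.
  have lim_s :
      (fun F : rkhs => 2 * (eval_comb F0 s - eval_comb F s) - sqk s) @ A -->
      2 * (eval_comb F0 s - eval_comb f s) - sqk s.
    apply: cvgB; last exact: cvg_cst.
    by apply: cvgMr; apply: cvgB => //; exact: cvg_cst.
  apply: (closed_cvg [set y : R | y <= e ^+ 2] _ _ _ lim_s).
    exact: closed_le.
  apply: filterS AF0 => F /= F0F; rewrite -(E F).
  have /le_trans := rk_sqrnorm_bound (F0 - F) s; apply.
  by rewrite -sqr_rk_norm ler_pXn2r ?nnegrE ?normr_ge0 ?(ltW e0) ?(ltW F0F).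
have fP : f \in rk_pred.
  have [F0 _ F0f] := fnear 1 ltr01.
  have -> : f = (F0 : X -> R) - (fun x => F0 x - f x).
    by apply/funext => x; rewrite !fctE opprB addrC subrK.
  by rewrite rpredB ?rk_funP//; apply/asboolP; exists (1 ^+ 2).
apply/cvg_ex; exists (Rkhs fP : rkhs).
apply/cvgrPdist_lt => e e0.
have [F0 AF0 F0f] := fnear _ (divr_gt0 e0 (ltr0Sn R 1)).
apply: filterS AF0 => F /= F0F.
rewrite (splitr e) -(subrK F0 (Rkhs fP)) -addrA.
apply: (le_lt_trans (ler_normD _ _)); apply: ler_ltD => //.
by rewrite distrC; apply: rk_norm_le => //; rewrite ltW// divr_gt0.
Qed.

HB.instance Definition _ := Uniform_isComplete.Build rkhs rkhs_complete.

Section Precomposition.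
Variables (phi : X -> X) (k_phi : forall x y, k (phi x) (phi y) = k x y).

Let eval_comb_precomp f s :
  eval_comb (f \o phi) s = eval_comb f [seq (p.1, phi p.2) | p <- s].
Proof. by rewrite /eval_comb big_map. Qed.

Let rk_bound_precomp f M : rk_bound f M -> rk_bound (f \o phi) M.
Proof.
move=> fM s; rewrite eval_comb_precomp.
have -> : sqk s = sqk [seq (p.1, phi p.2) | p <- s]; last exact: fM.
rewrite /sqr_comb !eval_kernel_comb_sum big_map; apply: eq_bigr => p _.
by rewrite big_map; apply: eq_bigr => q _; rewrite k_phi.
Qed.

Lemma rk_precompP F : F \o phi \in rk_pred.
Proof.
have /asboolP[M FM] := rk_funP F.
by apply/asboolP; exists M; exact: rk_bound_precomp.
Qed.

Definition rk_precomp F : rkhs := Rkhs (rk_precompP F).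

Lemma rk_precomp_linear a F G :
  rk_precomp (a *: F + G) = a *: rk_precomp F + rk_precomp G.
Proof. exact: val_inj. Qed.

Lemma le_rk_norm_precomp F : `|rk_precomp F| <= `|F|.
Proof.
apply: rk_norm_le => //; apply: rk_bound_precomp.
by rewrite sqr_rk_norm; exact: rk_sqrnorm_bound.
Qed.

End Precomposition.

End ReproducingKernel.

Arguments rk_parallelogram {R X} k.
Arguments rk_comb {R X} k s.
Arguments rk_sect {R X} k x.

(** * Complexification of a real Hilbert space *)

(** The parallelogram law is a parameter of the type because the scalar
    product, hence the Hilbert space structure to be inferred from the type,
    depends on it. *)
Record cplx (R : realType) (V : completeNormedModType R)
  (para : parallelogram_law V) := Cplx { cre : V ; cim : V }.

Section ComplexificationTheory.
Variables (R : realType) (V : completeNormedModType R).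
Variable para : parallelogram_law V.
Local Notation Re := (@complex.Re R).
Local Notation Im := (@complex.Im R).

Local Notation C := (cplx para).
Local Notation Cplx := (Cplx para).
Implicit Types z w : C.

HB.instance Definition _ := gen_eqMixin C.
HB.instance Definition _ := gen_choiceMixin C.

Definition cplx_add z w := Cplx (cre z + cre w) (cim z + cim w).
Definition cplx_opp z := Cplx (- cre z) (- cim z).
(** Multiplication by i maps the pair (x, y), read as x + i y, to (-y, x). *)
Definition cplx_scale (c : R[i]) z :=
  Cplx (Re c *: cre z - Im c *: cim z) (Re c *: cim z + Im c *: cre z).

Let cplx_addA : associative cplx_add.
Proof. by move=> x y z; rewrite /cplx_add /= !addrA. Qed.

Let cplx_addC : commutative cplx_add.
Proof.
by move=> x y; rewrite /cplx_add /= addrC [cim x + _]addrC.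
Qed.

Let cplx_add0 : left_id (Cplx 0 0) cplx_add.
Proof. by case=> x y; rewrite /cplx_add /= !add0r. Qed.

Let cplx_addN : left_inverse (Cplx 0 0) cplx_opp cplx_add.
Proof. by case=> x y; rewrite /cplx_add /= !addNr. Qed.

HB.instance Definition _ :=
  GRing.isZmodule.Build C cplx_addA cplx_addC cplx_add0 cplx_addN.

Let cplx_scaleA a b z : cplx_scale a (cplx_scale b z) = cplx_scale (a * b) z.
Proof.
case: a b z => [a a'] [b b'] [x y]; rewrite /cplx_scale /=; congr Cplx.
  rewrite !(scalerBr, scalerBl, scalerDr, scalerDl, scalerA) !opprD.
  by rewrite [- (_ *: y) - _]addrC addrACA.
rewrite !(scalerBr, scalerBl, scalerDr, scalerDl, scalerA).
by rewrite [_ *: x - _]addrC addrACA.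
Qed.

Let cplx_scale1 : left_id 1 cplx_scale.
Proof. by case=> x y; rewrite /cplx_scale /= !scale1r !scale0r subr0 addr0. Qed.

Let cplx_scaleDr : right_distributive cplx_scale +%R.
Proof.
move=> a [x y] [x' y']; rewrite /cplx_scale /=; congr Cplx.
  by rewrite !scalerDr opprD addrACA.
by rewrite !scalerDr addrACA.
Qed.

Let cplx_scaleDl z : {morph cplx_scale^~ z : a b / a + b}.
Proof.
move=> [a a'] [b b']; case: z => x y; rewrite /cplx_scale /=; congr Cplx.
  by rewrite !scalerDl opprD addrACA.
by rewrite !scalerDl addrACA.
Qed.

HB.instance Definition _ := GRing.Zmodule_isLmodule.Build R[i] C
  cplx_scaleA cplx_scale1 cplx_scaleDr cplx_scaleDl.

Lemma creB z w : cre (z - w) = cre z - cre w. Proof. by []. Qed.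
Lemma cimB z w : cim (z - w) = cim z - cim w. Proof. by []. Qed.

Definition cplx_sqrnorm z : R := `|cre z| ^+ 2 + `|cim z| ^+ 2.

Lemma cplx_sqrnorm_ge0 z : 0 <= cplx_sqrnorm z.
Proof. by rewrite addr_ge0 ?sqr_ge0. Qed.

Definition cplx_norm z : R[i] := (Num.sqrt (cplx_sqrnorm z))%:C%C.

Let cplx_normD z w : cplx_norm (z + w) <= cplx_norm z + cplx_norm w.
Proof.
rewrite /cplx_norm -rmorphD lecR.
set s := Num.sqrt (cplx_sqrnorm z); set s' := Num.sqrt (cplx_sqrnorm w).
have s0 : 0 <= s by exact: sqrtr_ge0.
have s0' : 0 <= s' by exact: sqrtr_ge0.
rewrite -[leRHS]ger0_norm ?addr_ge0// -sqrtr_sqr ler_sqrt ?sqr_ge0//.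
have hs : s ^+ 2 = cplx_sqrnorm z by rewrite sqr_sqrtr// cplx_sqrnorm_ge0.
have hs' : s' ^+ 2 = cplx_sqrnorm w by rewrite sqr_sqrtr// cplx_sqrnorm_ge0.
move: hs hs'; rewrite /cplx_sqrnorm /=.
have hD (x y : V) : `|x + y| ^+ 2 <= (`|x| + `|y|) ^+ 2.
  by rewrite ler_pXn2r ?nnegrE ?addr_ge0 ?ler_normD.
have := hD (cim z) (cim w); have := hD (cre z) (cre w).
move: (normr_ge0 (cre z)) (normr_ge0 (cim z)).
move: (normr_ge0 (cre w)) (normr_ge0 (cim w)).
move: `|cre z| `|cim z| `|cre w| `|cim w|.
move=> p q p' q' p'0 q'0 p0 q0 h1 h2 hs hs'.
have CS : p * p' + q * q' <= s * s'.
  rewrite -(@ler_pXn2r _ 2) ?nnegrE ?addr_ge0 ?mulr_ge0//.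
  rewrite exprMn hs hs'; have := sqr_ge0 (p * q' - p' * q); nra.
nra.
Qed.

Let cplx_normZ c z : cplx_norm (c *: z) = `|c| * cplx_norm z.
Proof.
rewrite /cplx_norm normc_def -rmorphM -sqrtrM ?addr_ge0 ?sqr_ge0//.
congr (Num.sqrt _)%:C%C.
rewrite /cplx_sqrnorm /= sqr_normB// sqr_normD// !normrZ.
rewrite !polarZl// !polarZr// polarC !exprMn !real_normK ?num_real//; ring.
Qed.

Let cplx_norm0_eq0 z : cplx_norm z = 0 -> z = 0.
Proof.
move=> [] /eqP; rewrite sqrtr_eq0 => z0.
have : cplx_sqrnorm z == 0 by rewrite eq_le z0 cplx_sqrnorm_ge0.
rewrite paddr_eq0 ?sqr_ge0// !sqrf_eq0 !normr_eq0.
by case: z {z0} => x y /= /andP[/eqP-> /eqP->].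
Qed.

HB.instance Definition _ := @Lmodule_isNormed.Build R[i] C
  cplx_norm cplx_normD cplx_normZ cplx_norm0_eq0.

Lemma cplx_normE z : `|z| = (Num.sqrt (`|cre z| ^+ 2 + `|cim z| ^+ 2))%:C%C.
Proof. by []. Qed.

Lemma cre_norm_le z : `|cre z|%:C%C <= `|z|.
Proof.
rewrite cplx_normE lecR -[leLHS]normr_id -sqrtr_sqr.
by rewrite ler_sqrt ?addr_ge0 ?sqr_ge0// lerDl sqr_ge0.
Qed.

Lemma cim_norm_le z : `|cim z|%:C%C <= `|z|.
Proof.
rewrite cplx_normE lecR -[leLHS]normr_id -sqrtr_sqr.
by rewrite ler_sqrt ?addr_ge0 ?sqr_ge0// lerDr sqr_ge0.
Qed.

Lemma cplx_norm_le z : `|z| <= (`|cre z| + `|cim z|)%:C%C.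
Proof.
rewrite cplx_normE lecR -[leRHS]ger0_norm ?addr_ge0// -sqrtr_sqr.
rewrite ler_sqrt ?sqr_ge0// sqrrD [leRHS]addrAC lerDl.
by rewrite mulrn_wge0// mulr_ge0.
Qed.

Lemma cplx_complete (A : set_system C) : ProperFilter A -> cauchy A -> cvg A.
Proof.
move=> AA /cauchyP Acauchy.
have proj (pr : C -> V) : (forall z w, pr (z - w) = pr z - pr w) ->
    (forall z, `|pr z|%:C%C <= `|z|) -> cvg (pr @ A).
  move=> prB prle; apply/cauchy_cvgP/cauchyP => e e0.
  have [z0 Az0] : exists z, A (ball z e%:C%C) by apply: Acauchy; rewrite ltcR.
  exists (pr z0); rewrite /fmap /=; apply: (@filterS _ A _ _ _ _ Az0) => z.
  rewrite -!ball_normE /= -prB => z0z.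
  by rewrite -ltcR (le_lt_trans (prle _)).
have /cvg_ex[/= x Ax] := proj (@cre _ _ _) creB cre_norm_le.
have /cvg_ex[/= y Ay] := proj (@cim _ _ _) cimB cim_norm_le.
apply/cvg_ex; exists (Cplx x y); apply/cvgrPdist_lt => e.
case: e => e e'; rewrite ltcE /= => /andP[/eqP-> e0].
have e20 : 0 < e / 2 by rewrite divr_gt0.
have [/cvgrPdist_lt/(_ _ e20) hx /cvgrPdist_lt/(_ _ e20) hy] := (Ax, Ay).
apply: filterS2 hx hy => z /= zx zy.
rewrite (le_lt_trans (cplx_norm_le _))// ltcR (splitr e).
by rewrite ltrD.
Qed.

HB.instance Definition _ := Uniform_isComplete.Build C cplx_complete.

Definition cplx_dot z w : R[i] :=
  ((polar (cre z) (cre w) + polar (cim z) (cim w)) +i*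
   (polar (cim z) (cre w) - polar (cre z) (cim w)))%C.

Let cplx_dot_linearl w : GRing.linear_for *%R (cplx_dot^~ w).
Proof.
move=> [a b] z z'; rewrite /cplx_dot /=; congr Complex.
  rewrite !(polarDl para) ?(polarNl para) !(polarZl para); ring.
rewrite !(polarDl para) ?(polarNl para) !(polarZl para); ring.
Qed.

Let cplx_dotC z w : cplx_dot z w = (-1) ^+ false * Num.conj (cplx_dot w z).
Proof.
rewrite expr0 mul1r -[Num.conj _]/(conjc _); case: z w => x y [x' y'] /=.
by rewrite /cplx_dot /= opprB !(polarC x') !(polarC y').
Qed.

Let cplx_dot_linearr z : GRing.linear_for (Num.conj \; *%R) (cplx_dot z).
Proof.
move=> c w w'; rewrite cplx_dotC cplx_dot_linearl /=.
by rewrite !expr0 !mul1r rmorphD rmorphM/= !(cplx_dotC z) expr0 !mul1r.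
Qed.

HB.instance Definition _ := @bilinear_isBilinear.Build R[i] C C R[i]
  ( *%R ) (Num.conj \; *%R) cplx_dot (cplx_dot_linearl, cplx_dot_linearr).

HB.instance Definition _ := @isHermitianSesquilinear.Build R[i] C false
  (@Num.conj R[i]) cplx_dot cplx_dotC.

Let cplx_dotxx z : cplx_dot z z = `|z| ^+ 2.
Proof.
rewrite cplx_normE -rmorphXn sqr_sqrtr ?addr_ge0 ?sqr_ge0//.
by rewrite /cplx_dot !polarxx [polar (cim z) _]polarC subrr.
Qed.

Let cplx_dot_gt0 z : z != 0 -> 0 < cplx_dot z z.
Proof. by move=> z0; rewrite cplx_dotxx exprn_gt0// normr_gt0. Qed.

HB.instance Definition _ := @isDotProduct.Build R[i] C cplx_dot cplx_dot_gt0.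

HB.instance Definition _ := @isHilbert.Build R C cplx_dot
  (fun z => esym (cplx_dotxx z)).

Lemma hdotE z w : hdot z w = cplx_dot z w.
Proof. by []. Qed.

End ComplexificationTheory.

(** * Operations on positive semidefinite kernels *)

Section PsdKernels.
Variables (R : realType) (X : Type).
Implicit Types (k l : X -> X -> R) (s : seq (R * X)).

Lemma sqr_comb_sum k s : sqr_comb k s =
  \sum_(p <- s) \sum_(q <- s) p.1 * q.1 * k p.2 q.2.
Proof. exact: eval_kernel_comb_sum. Qed.

Lemma psd_rank1 (f : X -> R) : psd (fun x y => f x * f y).
Proof.
split=> [x y|s]; first by rewrite mulrC.
have -> : sqr_comb (fun x y => f x * f y) s = eval_comb f s ^+ 2.
  rewrite sqr_comb_sum expr2 {1}/eval_comb mulr_suml; apply: eq_bigr => p _.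
  by rewrite mulr_sumr; apply: eq_bigr => q _; ring.
exact: sqr_ge0.
Qed.

Lemma sqr_combD k l s :
  sqr_comb (fun x y => k x y + l x y) s = sqr_comb k s + sqr_comb l s.
Proof.
rewrite !sqr_comb_sum -big_split; apply: eq_bigr => p _ /=.
by rewrite -big_split; apply: eq_bigr => q _; rewrite mulrDr.
Qed.

Lemma sqr_comb_kernelZ (c : R) k s :
  sqr_comb (fun x y => c * k x y) s = c * sqr_comb k s.
Proof.
rewrite !sqr_comb_sum mulr_sumr; apply: eq_bigr => p _ /=.
by rewrite mulr_sumr; apply: eq_bigr => q _; rewrite mulrCA.
Qed.

Lemma psdD k l : psd k -> psd l -> psd (fun x y => k x y + l x y).
Proof.
move=> [kC k0] [lC l0]; split=> [x y|s]; first by rewrite kC lC.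
by rewrite sqr_combD addr_ge0.
Qed.

Lemma psdZ (c : R) k : 0 <= c -> psd k -> psd (fun x y => c * k x y).
Proof.
move=> c0 [kC k0]; split=> [x y|s]; first by rewrite kC.
by rewrite sqr_comb_kernelZ mulr_ge0.
Qed.

Lemma psd_lim (k : (X -> X -> R)^nat) l : (forall n, psd (k n)) ->
  (forall x y, k n x y @[n --> \oo] --> l x y) -> psd l.
Proof.
move=> kpsd kl; split=> [x y|s].
  have := kl y x; rewrite (_ : (fun n => k n y x) = (fun n => k n x y)).
    by apply: cvg_unique (kl x y); exact: Rhausdorff.
  by apply/funext => n; exact: (kpsd n).1.
have sl : sqr_comb (k n) s @[n --> \oo] --> sqr_comb l s.
  under eq_fun do rewrite sqr_comb_sum.
  rewrite sqr_comb_sum; apply: cvg_big => [|p _]; first exact: add_continuous.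
  apply: cvg_big => [|q _]; first exact: add_continuous.
  by apply: cvgMr; exact: kl.
apply: (closed_cvg [set y : R | 0 <= y] _ _ _ sl); first exact: closed_ge.
by apply: nearW => n; exact: (kpsd n).2.
Qed.

Lemma sqr_comb_cons k c x s : (forall x y, k x y = k y x) ->
  sqr_comb k ((c, x) :: s) =
  c ^+ 2 * k x x + sqr_comb k s + 2 * c * eval_comb (k x) s.
Proof.
move=> kC; rewrite -cat1s sqr_comb_cat//.
have E y : kernel_comb k [:: (c, x)] y = c * k x y.
  by rewrite /kernel_comb /eval_comb big_seq1.
have -> : sqr_comb k [:: (c, x)] = c ^+ 2 * k x x.
  by rewrite /sqr_comb /eval_comb big_seq1 E mulrA expr2.
have -> : eval_comb (kernel_comb k [:: (c, x)]) s = c * eval_comb (k x) s.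
  by rewrite -eval_combZ; apply: eq_bigr => q _; rewrite E.
by rewrite mulrA.
Qed.

(** The projection of the kernel away from the point v. If [k v v = 0] then the
    quotient is 0, which is correct as the row of v vanishes already. *)
Definition schur_complement k v x y := k x y - k x v * k v y / k v v.

(** The degenerate case of the Cauchy-Schwarz inequality. *)
Lemma psd_row0 k v x : psd k -> k v v = 0 -> k v x = 0.
Proof.
move=> kpsd kv0; have kC := kpsd.1.
have H (t : R) : 0 <= k x x + 2 * t * k v x.
  have := sqr_comb_ge0 [:: (t, v); (1, x)] kpsd.
  rewrite !sqr_comb_cons// kv0 /sqr_comb !eval_comb_nil eval_comb1; lra.
have [//|kvx] := eqVneq (k v x) 0.
have := H (- (k x x + 1) / 2 / k v x).
rewrite [2 * _ * _](_ : _ = - (k x x + 1)); first lra.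
by field.
Qed.

(** The form of the Schur complement at s is the minimum over c of the form of
    k at s + c v. *)
Lemma psd_schur_complement k v : psd k -> psd (schur_complement k v).
Proof.
move=> kpsd; have kC := kpsd.1; split=> [x y|s].
  by rewrite /schur_complement (kC y x) (kC x v) (kC y v) [k v x * _]mulrC.
have -> : sqr_comb (schur_complement k v) s =
    sqr_comb k s - (k v v)^-1 * eval_comb (k v) s ^+ 2.
  have -> : eval_comb (k v) s ^+ 2 = sqr_comb (fun x y => k v x * k v y) s.
    rewrite sqr_comb_sum expr2 {1}/eval_comb mulr_suml; apply: eq_bigr => p _.
    by rewrite mulr_sumr; apply: eq_bigr => q _; ring.
  rewrite -mulNr -sqr_comb_kernelZ -sqr_combD; congr sqr_comb.
  apply/funext => x; apply/funext => y.
  by rewrite /schur_complement (kC x v); ring.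
have [kv0|kv0] := eqVneq (k v v) 0.
  by rewrite kv0 invr0 mul0r subr0 sqr_comb_ge0.
have := sqr_comb_ge0 ((- eval_comb (k v) s / k v v, v) :: s) kpsd.
rewrite sqr_comb_cons//; set b := eval_comb _ _.
suff -> : (- b / k v v) ^+ 2 * k v v + sqr_comb k s + 2 * (- b / k v v) * b =
  sqr_comb k s - (k v v)^-1 * b ^+ 2 by [].
by field.
Qed.

Lemma schur_complement_row0 k v y : psd k -> schur_complement k v v y = 0.
Proof.
move=> kpsd; rewrite /schur_complement; have [kv0|kv0] := eqVneq (k v v) 0.
  by rewrite (psd_row0 y kpsd kv0) mulr0 mul0r subrr.
by rewrite mulrAC divff// mul1r subrr.
Qed.

Lemma psd_diag_ge0 k v : psd k -> 0 <= k v v.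
Proof.
move=> kpsd; have := sqr_comb_ge0 [:: (1, v)] kpsd.
by rewrite /sqr_comb eval_comb1 /kernel_comb eval_comb1.
Qed.

(** The Schur product theorem, by induction on the number of points. With v the
    first point, k is the sum of its Schur complement, whose row at v is 0 so
    that v drops out of the product with l, and of a rank one kernel, whose
    product with l is l with rescaled coefficients. *)
Lemma psdM k l : psd k -> psd l -> psd (fun x y => k x y * l x y).
Proof.
move=> kpsd lpsd; split=> [x y|s]; first by rewrite kpsd.1 lpsd.1.
elim: s k kpsd => [|[c v] s IH] k kpsd.
  by rewrite /sqr_comb eval_comb_nil.
pose k' := schur_complement k v.
have k'psd : psd k' := psd_schur_complement v kpsd.
have -> : (fun x y => k x y * l x y) =
    (fun x y => k' x y * l x y + (k v v)^-1 * (k v x * k v y * l x y)).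
  apply/funext => x; apply/funext => y.
  by rewrite /k' /schur_complement (kpsd.1 x v); ring.
rewrite sqr_combD addr_ge0//.
  rewrite sqr_comb_cons; last by move=> x y; rewrite k'psd.1 lpsd.1.
  rewrite /k' schur_complement_row0// mul0r mulr0 add0r.
  rewrite [eval_comb _ _]big1 ?mulr0 ?addr0 ?IH// => p _.
  by rewrite schur_complement_row0// mul0r mulr0.
rewrite sqr_comb_kernelZ mulr_ge0 ?invr_ge0 ?psd_diag_ge0//.
rewrite (_ : sqr_comb _ _ =
    sqr_comb l [seq (p.1 * k v p.2, p.2) | p <- (c, v) :: s]) ?sqr_comb_ge0//.
rewrite !sqr_comb_sum big_map; apply: eq_bigr => p _.
by rewrite big_map; apply: eq_bigr => q _ /=; ring.
Qed.

Lemma psd_expn k n : psd k -> psd (fun x y => k x y ^+ n).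
Proof.
move=> kpsd; elim: n => [|n IH].
  by have := psd_rank1 (cst 1); under eq_fun do under eq_fun do rewrite mul1r.
by under eq_fun do under eq_fun do rewrite exprS; exact: psdM.
Qed.

(** The exponential series has nonnegative coefficients. *)
Lemma psd_expR k : psd k -> psd (fun x y => expR (k x y)).
Proof.
move=> kpsd; apply: (@psd_lim (fun n x y => series (exp_coeff (k x y)) n)).
  elim=> [|n IH].
    have := psd_rank1 (cst 0); congr psd; apply/funext => x; apply/funext => y.
    by rewrite /series /= big_geq// mul0r.
  under eq_fun do under eq_fun do rewrite seriesSr /exp_coeff /= mulrC.
  by apply: psdD => //; apply: psdZ; [rewrite invr_ge0|exact: psd_expn].
by move=> x y; exact: is_cvg_series_exp_coeff.
Qed.

End PsdKernels.

Section GaussianKernel.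
Variables (R : realType) (V : normedModType R).
Hypothesis para : parallelogram_law V.

Lemma psd_polar : psd (@polar R V).
Proof.
split=> [|s]; first exact: polarC.
have linr x (t : seq (R * V)) : \sum_(q <- t) q.1 * polar x q.2 =
    polar x (\sum_(q <- t) q.1 *: q.2).
  elim/big_ind2: _ => [|a b c d -> ->|q _].
  - by have := polarZr para 0 x 0; rewrite scale0r mul0r.
  - by rewrite polarDr.
  - by rewrite polarZr.
have -> : sqr_comb (@polar R V) s = `|\sum_(p <- s) p.1 *: p.2| ^+ 2.
  rewrite -polarxx -linr; apply: eq_bigr => p _; congr (_ * _).
  rewrite polarC -linr.
  by rewrite /kernel_comb; apply: eq_bigr => q _; rewrite polarC.
exact: sqr_ge0.
Qed.

Definition gauss (v w : V) : R := expR (- `|v - w| ^+ 2).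

(** Expanding |v - w|^2 writes the kernel as the rank one kernel exp(-|v|^2)
    exp(-|w|^2) times the exponential of twice the scalar product. *)
Lemma psd_gauss : psd gauss.
Proof.
have -> : gauss = (fun v w => expR (- `|v| ^+ 2) * expR (- `|w| ^+ 2) *
    expR (2 * polar v w)).
  apply/funext => v; apply/funext => w; rewrite -!expRD /gauss; congr expR.
  by rewrite sqr_normB//; ring.
apply: psdM; first exact: (psd_rank1 (fun v => expR (- `|v| ^+ 2))).
by apply: psd_expR; apply: psdZ => //; exact: psd_polar.
Qed.

End GaussianKernel.

(** * The Gaussian representation *)

Section GaussSpace.
Variables (R : realType) (V : normedModType R).
Variable para : parallelogram_law V.

Definition gauss_kernel := PsdKernel (psd_gauss para).
Local Notation k := gauss_kernel.
Local Notation sect := (rk_sect k).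

Lemma gaussxx (v : V) : gauss v v = 1.
Proof. by rewrite /gauss subrr normr0 expr0n oppr0 expR0. Qed.

(** The squared distance of e_v and e_w is 2 - 2 exp(-|v - w|^2). *)
Lemma rk_sect_continuous : continuous sect.
Proof.
move=> v; apply/cvgrPdist_lt => e e0.
have gcvg : 2 - 2 * gauss v w @[w --> v] --> (2 - 2 * 1 : R).
  apply: cvgB; first exact: cvg_cst.
  apply: cvgMr; rewrite -(gaussxx v).
  apply: continuous_comp; last exact: continuous_expR.
  apply: cvgN; rewrite expr2; under eq_fun do rewrite expr2.
  have d : `|v - w| @[w --> v] --> `|v - v|.
    by apply: cvg_norm; apply: cvgB; [exact: cvg_cst|exact: cvg_id].
  exact: cvgM.
rewrite mulr1 subrr in gcvg.
have /cvgrPdist_lt/(_ _ (exprn_gt0 2 e0)) := gcvg.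
apply: filterS => w; rewrite sub0r normrN => we.
rewrite -(@ltr_pXn2r _ 2) ?nnegrE ?normr_ge0 ?(ltW e0)//.
apply: le_lt_trans we; rewrite (le_trans _ (ler_norm _))//.
rewrite (sqr_normB (rk_parallelogram k)) -!polarxx !polar_rk_sect /= !gaussxx.
lra.
Qed.

Definition vanishes (f : V -> R) :=
  forall e : R, 0 < e -> exists M, forall w, M <= `|w| -> `|f w| < e.

Lemma gauss_vanishes (v : V) : vanishes (gauss v).
Proof.
move=> e e0; exists (`|v| + (1 + e^-1)) => w Mw.
have ie0 : 0 < e^-1 by rewrite invr_gt0.
have h : 1 + e^-1 <= `|v - w|.
  have := lerB_dist w v; rewrite distrC; lra.
rewrite ger0_norm ?expR_ge0// /gauss expRN -[ltRHS]invrK.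
rewrite ltf_pV2 ?posrE ?expR_gt0//.
apply: lt_le_trans (expR_ge1Dx _).
nra.
Qed.

(** True for the e_x, hence for their combinations, and these approximate f in
    norm, hence uniformly on V as |e_v| = 1. *)
Lemma rkhs_vanishes (f : rkhs k) : vanishes f.
Proof.
have comb s : vanishes (rk_comb k s).
  elim: s => [|[c x] s IH] e e0.
    by exists 0 => w _; rewrite rk_comb_nil normr0.
  have d0 : 0 < e / 2 / (`|c| + 1) by rewrite !divr_gt0// ltr_wpDl.
  have [M hM] := gauss_vanishes x d0.
  have e20 : 0 < e / 2 by rewrite divr_gt0.
  have [M' hM'] := IH _ e20; exists (Num.max M M') => w.
  rewrite ge_max rk_comb_cons => /andP[/hM h1 /hM' h2].
  rewrite -[X in `|X|]/(c * rk_sect k x w + rk_comb k s w).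
  rewrite (le_lt_trans (ler_normD _ _))// (splitr e) ltrD// rk_sectE.
  rewrite ltr_pdivlMr ?ltr_wpDl// in h1.
  rewrite normrM mulrC; apply: le_lt_trans h1.
  by rewrite ler_wpM2l// lerDl.
move=> e e0; have e20 : 0 < e / 2 by rewrite divr_gt0.
have [s fs] := rk_comb_dense f e20.
have [M hM] := comb s _ e20; exists M => w /hM ws.
rewrite -(subrK (rk_comb k s w) (f w)) (le_lt_trans (ler_normD _ _))//.
rewrite (splitr e) ltrD//; apply: le_lt_trans fs.
have := rk_eval_le (f - rk_comb k s) w.
by rewrite [k w w]gaussxx sqrtr1 mulr1.
Qed.

End GaussSpace.

Section GaussRepresentation.
Variables (R : realType) (G : topologicalGroupType) (V : normedModType R).
Variable para : parallelogram_law V.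
Variables (a : G -> V -> V) (aff : affine_isometric_action a).
Local Notation k := (gauss_kernel para).
Local Notation sect := (rk_sect k).
Local Notation H := (cplx (rk_parallelogram k)).

Lemma action1 v : a 1%g v = v. Proof. exact: (aia_action aff).1. Qed.

Lemma actionM g h v : a (g * h)%g v = a g (a h v).
Proof. exact: (aia_action aff).2. Qed.

Lemma action_orbit_continuous v : continuous (a ^~ v).
Proof.
move=> g; apply: (@continuous_comp _ _ _ (fun g => (g, v))
  (fun gx : G * V => a gx.1 gx.2)); last exact: (aia_continuous aff).
by apply: cvg_pair; [exact: cvg_id|exact: cvg_cst].
Qed.

Lemma gauss_action g v w : k (a g v) (a g w) = k v w.
Proof. by rewrite /= /gauss (aia_isometric aff). Qed.

(** Composition with the inverse makes this a left action, under which g maps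
    e_v to e_(g v). *)
Definition translate g (f : rkhs k) := rk_precomp (gauss_action g^-1%g) f.

Lemma translateE g f v : translate g f v = f (a g^-1%g v). Proof. by []. Qed.

Lemma translate1 f : translate 1%g f = f.
Proof. by apply/val_inj/funext => v /=; rewrite invg1 action1. Qed.

Lemma translateM g h f : translate (g * h)%g f = translate g (translate h f).
Proof. by apply/val_inj/funext => v /=; rewrite invgM actionM. Qed.

Lemma translate_linear g : linear (translate g).
Proof. by move=> c x y; exact: rk_precomp_linear. Qed.

Lemma translateD g x y : translate g (x + y) = translate g x + translate g y.
Proof. exact: val_inj. Qed.

Lemma translateB g x y : translate g (x - y) = translate g x - translate g y.
Proof. exact: val_inj. Qed.

Lemma translateZ g c x : translate g (c *: x) = c *: translate g x.
Proof. exact: val_inj. Qed.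

Lemma norm_translate g f : `|translate g f| = `|f|.
Proof.
apply/le_anti; rewrite le_rk_norm_precomp/=.
rewrite -{1}[f]translate1 -(mulVg g) translateM.
exact: le_rk_norm_precomp.
Qed.

Lemma polar_translate g x y : polar (translate g x) (translate g y) = polar x y.
Proof. by rewrite /polar -translateD -translateB !norm_translate. Qed.

Lemma translate_sect g v : translate g (sect v) = sect (a g v).
Proof.
apply/val_inj/funext => w; rewrite -[LHS]/(sect v (a g^-1%g w)) rk_sectE.
rewrite -(gauss_action g v) -actionM mulgV action1.
exact/esym/rk_sectE.
Qed.

(** The orbit map is continuous for each e_v, hence for finite combinations;
    the translations being isometric, density extends this to all f. *)
Lemma translate_continuous f : continuous (translate ^~ f).
Proof.
have comb s : continuous (translate ^~ (rk_comb k s)).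
  elim: s => [|[c x] s IH] g.
    have E h : translate h (rk_comb k [::]) = rk_comb k [::].
      by rewrite !rk_comb_nil; exact: val_inj.
    rewrite /continuous_at E; under eq_fun do rewrite E.
    exact: cvg_cst.
  have E h : translate h (rk_comb k ((c, x) :: s)) =
      c *: sect (a h x) + translate h (rk_comb k s).
    by rewrite rk_comb_cons translate_linear translate_sect.
  rewrite /continuous_at E; under eq_fun do rewrite E.
  apply: cvgD; last exact: IH.
  apply: cvgZr; apply: (@continuous_comp _ _ _ (a ^~ x) sect).
    exact: action_orbit_continuous.
  exact: rk_sect_continuous.
move=> g; apply/cvgrPdist_lt => e e0.
have e30 : 0 < e / 3 by rewrite divr_gt0.
have [s fs] := rk_comb_dense f e30.
have /cvgrPdist_lt/(_ _ e30) := comb s g.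
apply: filterS => h /= gh.
have near u : `|translate u f - translate u (rk_comb k s)| < e / 3.
  by have := norm_translate u (f - rk_comb k s); rewrite translateB => ->.
have := near g; have := near h; rewrite [in X in X -> _]distrC.
move: (translate g f) (translate h f) (translate g _) (translate h _) gh.
move=> x y x' y' xy' yy' xx'.
have -> : x - y = (x - x') + (x' - y') + (y' - y) by rewrite !addrA !subrK.
have := ler_normD (x - x') (x' - y').
have := ler_normD (x - x' + (x' - y')) (y' - y).
lra.
Qed.

Definition gauss_rep g (z : H) : H :=
  Cplx (rk_parallelogram k) (translate g (cre z)) (translate g (cim z)).

Lemma gauss_rep_unitary : unitary_representation gauss_rep.
Proof.
split.
- split=> [[x y]|g h [x y]]; rewrite /gauss_rep /=.
    by rewrite !translate1.
  by rewrite !translateM.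
- move=> g c z w; rewrite /gauss_rep; congr Cplx.
    by rewrite translateD translateB !translateZ.
  by rewrite translateD translateD !translateZ.
- move=> g z w; rewrite !hdotE /cplx_dot /=.
  by rewrite !polar_translate.
- move=> z g; apply/cvgrPdist_lt => -[e e'].
  rewrite ltcE /= => /andP[/eqP-> e0].
  have e20 : 0 < e / 2 by rewrite divr_gt0.
  have /cvgrPdist_lt/(_ _ e20) hx := @translate_continuous (cre z) g.
  have /cvgrPdist_lt/(_ _ e20) hy := @translate_continuous (cim z) g.
  apply: filterS2 hx hy => h /= hx hy.
  by rewrite (le_lt_trans (cplx_norm_le _))// ltcR (splitr e) ltrD.
Qed.

(** An invariant function takes the value f v along the whole orbit of v, which
    leaves every ball, whereas f vanishes at infinity. *)
Lemma unbounded_no_invariant_vector (K : set G) :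
  (forall v M, exists2 h, K h & M <= `|a h v|) ->
  ~ has_invariant_vector K gauss_rep.
Proof.
move=> Kunb [z z0 zK].
have vanish (f : rkhs k) : (forall h, K h -> translate h f = f) -> f = 0.
  move=> fK; apply/val_inj/funext => v; apply/eqP.
  rewrite -normr_le0 leNgt; apply/negP => fv.
  have [M hM] := rkhs_vanishes f fv; have [h Kh /hM] := Kunb v M.
  by rewrite -{1}(fK h Kh) translateE -actionM mulVg action1 ltxx.
move/eqP: z0; apply; case: z zK => x y zK.
by congr Cplx; apply: vanish => h /zK [].
Qed.

(** The matrix coefficient of the vector e_v at h is exp(-|h v - v|^2). *)
Lemma C0_rep_proper (K : set G) v r : C0_representation K gauss_rep ->
  exists2 C, compact C & [set h | K h /\ `|a h v - v| <= r] `<=` C.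
Proof.
pose z : H := Cplx (rk_parallelogram k) (sect v) 0.
move=> /(_ z z _ (expR_gt0 (- r ^+ 2)))[C [Ccpt CK Csmall]].
exists C => // h [Kh hr]; apply: contrapT => Ch.
have := le_lt_trans (normc_ge_Re _) (Csmall h (conj Kh Ch)); apply/negP.
rewrite ltcR -leNgt hdotE /= translate_sect.
have -> : translate h 0 = 0 by exact: val_inj.
rewrite polarxx normr0 expr0n addr0 polar_rk_sect /=.
apply: le_trans (ler_norm _); rewrite ler_expR lerN2.
by rewrite ler_pXn2r ?nnegrE// (le_trans _ hr).
Qed.

End GaussRepresentation.

(** * Bounded or proper orbits *)

Section BoundedOrProper.
Variables (R : realType) (G : topologicalGroupType) (V : normedModType R).
Hypothesis para : parallelogram_law V.
Variables (a : G -> V -> V) (aff : affine_isometric_action a).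
Variables (C K : set G).
Hypotheses (Ccpt : compact C)
  (GCK : forall g, exists c h, [/\ C c, K h & g = (c * h)%g]).

Let orbit_bounded_on_C v : exists M, forall c, C c -> `|a c v - v| <= M.
Proof.
have : compact ((fun c => a c v - v) @` C).
  apply: continuous_compact => //; apply: continuous_subspaceT => c.
  apply: (@cvgB _ _ _ (nbhs c) _ (a ^~ v) (cst v)); last exact: cvg_cst.
  exact: action_orbit_continuous.
move=> /compact_bounded/pinfty_ex_gt0[M _ CM].
by exists M => c Cc; apply: CM; exists c.
Qed.

(** An element c h moves v by at most the displacement by h plus the
    displacement by c, and the latter is bounded on C. *)
Lemma bounded_of_bounded_on_subset v0 M0 :
  (forall h, K h -> `|a h v0| < M0) -> bounded_action a.
Proof.
move=> KM v; have [M CM] := orbit_bounded_on_C v.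
exists (M + `|v| + (M0 + `|v - v0| + `|v|)).
split=> [|B /ltW MB]; first exact: num_real.
move=> _ [g _ <-]; apply: le_trans MB.
have [c [h [Cc Kh ->]]] := GCK g; rewrite (actionM aff) /=.
have h1 : `|a c (a h v) - a c v| <= M0 + `|v - v0| + `|v|.
  rewrite (aia_isometric aff) (le_trans (ler_normB _ _))// lerD2r.
  rewrite -(subrK (a h v0) (a h v)) (le_trans (ler_normD _ _))//.
  by rewrite (aia_isometric aff) addrC lerD2r ltW// KM.
rewrite -(subrK (a c v) (a c _)) addrC (le_trans (ler_normD _ _))// lerD//.
by rewrite -(subrK v (a c v)) (le_trans (ler_normD _ _))// lerD2r CM.
Qed.

(** If every K-orbit is unbounded then the Gaussian representation is C_0 on K,
    and the elements g = c h moving v by at most r lie in the product of C and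
    of a compact set containing the h in K that move v by at most M + r, where
    M bounds the displacement of v by C. *)
Lemma howe_moore_bounded_or_proper : hausdorff_space G ->
  relative_howe_moore R K -> bounded_action a \/ proper_action a.
Proof.
move=> hsd HM.
have [[v0 [M0 KM]]|Kunb] :=
  pselect (exists v0 M0, forall h, K h -> `|a h v0| < M0).
  by left; exact: bounded_of_bounded_on_subset KM.
right=> v r.
have C0 : C0_representation K (gauss_rep (para := para) aff).
  have [inv|//] := HM _ _ (gauss_rep_unitary para aff).
  exfalso; apply: unbounded_no_invariant_vector inv => v' M.
  apply: contrapT => nh; apply: Kunb; exists v', M => h Kh.
  by rewrite ltNge; apply/negP => Mh; apply: nh; exists h.
have [M CM] := orbit_bounded_on_C v.
have [D Dcpt KD] := C0_rep_proper v (M + r) C0.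
have CDcpt : compact ((fun x : G * G => (x.1 * x.2)%g) @` (C `*` D)).
  apply: continuous_compact; last exact: compact_setX.
  by apply: continuous_subspaceT => x; exact: mulg_continuous.
apply: precompact_subset (compact_precompact hsd CDcpt) => g /=.
have [c [h [Cc Kh ->]]] := GCK g; rewrite (actionM aff) => cr.
exists (c, h) => //; split=> //=; apply: KD; split=> //.
rewrite -(aia_isometric aff c) -(subrK v (a c (a h v))) -addrA.
rewrite (le_trans (ler_normD _ _))// [M + r]addrC lerD// distrC CM//.
Qed.

End BoundedOrProper.

(** * Cocompact subgroups of locally compact groups *)

Section CompactTransversal.
Variables (G : topologicalGroupType) (N : groupClosed G).

Local Notation pr := (\pi_(coset_space N)%qT : G -> coset_space N).

(* The base point gives access to the cover characterization of compactness. *)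
HB.instance Definition _ := isPointed.Build (coset_space N) (pr 1%g).

Lemma pr_eq (x y : G) : pr x = pr y -> (x^-1 * y)%g \in N.
Proof. by move=> /eqmodP. Qed.

Lemma mulgr_continuous (h : G) : continuous (fun g : G => (g * h)%g).
Proof.
move=> g; apply: (@continuous_comp _ _ _ (fun g => (g, h))
  (fun x : G * G => (x.1 * x.2)%g)); last exact: mulg_continuous.
by apply: cvg_pair; [exact: cvg_id|exact: cvg_cst].
Qed.

(** The saturation of U is the union of its right translates by N. *)
Lemma pr_open (U : set G) : open U -> open (pr @` U).
Proof.
move=> Uop; rewrite -[open _]/(open (pr @^-1` (pr @` U))).
have -> : pr @^-1` (pr @` U) =
    \bigcup_(n in [set` N]) ((fun g => (g * n^-1)%g) @^-1` U).
  apply/seteqP; split=> [y [x Ux /pr_eq xy]|y [n /= nN Uyn]].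
    by exists (x^-1 * y)%g => //=; rewrite invgM invgK mulVKg.
  exists (y * n^-1)%g => //; apply/eqmodP; rewrite /= /coset_rel.
  by rewrite invgM invgK mulgVK.
apply: bigcup_open => n _; apply: open_comp => // x _.
exact: mulgr_continuous.
Qed.

(** The images of the interiors of compact neighbourhoods form an open cover of
    the coset space; C is the union of the neighbourhoods of a finite
    subcover. *)
Lemma cocompact_transversal : locally_compact [set: G] -> cocompact N ->
  exists2 C : set G, compact C &
    forall g, exists c h, [/\ C c, h \in N & g = (c * h)%g].
Proof.
move=> lcG cptN.
have cN : cover_compact [set: coset_space N] by rewrite -compact_cover.
have nb (x : G) : exists U, nbhs x U /\ compact U.
  have [U xU [Ucpt _]] := lcG x I; exists U; split=> //.
  have : \forall y \near x, [set: G] y -> U y := xU.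
  by apply: filterS => y; exact.
pose U x := sval (cid (nb x)).
have UP x : nbhs x (U x) /\ compact (U x) := svalP (cid (nb x)).
have [|y _|D _ Dcov] := cN G setT (fun x => pr @` (U x)^°).
- by move=> x _; apply: pr_open; exact: open_interior.
- exists (repr y) => //; exists (repr y); last exact: reprK.
  exact: (UP _).1.
exists (\big[setU/set0]_(x <- finmap.enum_fset D) U x).
  by apply: bigsetU_compact => x _; exact: (UP x).2.
move=> g; have [x xD [c Uc cg]] := Dcov (pr g) I.
exists c, (c^-1 * g)%g; split; last by rewrite mulVKg.
- by rewrite -bigcup_seq; exists x => //; exact: interior_subset.
- exact: pr_eq.
Qed.

End CompactTransversal.

Theorem proposition6p2 (R : realType) (G : topologicalGroupType)
    (hG : locally_compact_group G) :
  (forall N : groupClosed G,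
     closed [set` N] -> normal_subgroup N -> cocompact N ->
     relative_howe_moore R [set` N] -> BP_L2 R G) /\
  (howe_moore R G -> BP_L2 R G).
Proof.
have [hsd lcG] := hG; split=> [N _ _ cN HM|HM] d T mu a aff.
  have [C Ccpt GCN] := cocompact_transversal lcG cN.
  exact: (howe_moore_bounded_or_proper (L2_parallelogram mu) aff Ccpt GCN
    hsd HM).
have GG (g : G) : exists c h, [/\ [set 1%g] c, [set: G] h & g = (c * h)%g].
  by exists 1%g, g; split=> //; rewrite mul1g.
exact: (howe_moore_bounded_or_proper (L2_parallelogram mu) aff
  (@compact_set1 G 1%g) GG hsd HM).
Qed.
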